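(* Let $G$ be a $k$-chromatic graph with an implicit-edge $\{x,y\}$. Then in every proper $k$-coloring $c$ of $G$ we have $c(x)\neq c(y)$, and there exists at least one Kempe chain with colors $(c(x),c(y))$ with $x$ and $y$ at its extremes, that is, a $(c(x),c(y))$-Kempe chain containing a path with end-vertices $x$ and $y$.
   Context: All graphs are simple (undirected, no loops, no multiple edges). A $k$-coloring is a proper vertex coloring using a set of $k$ colors. A graph is $k$-chromatic if its chromatic number equals $k$. For distinct vertices $i,j$ of $G$, $G-ij$ denotes $G$ with the edge $\{i,j\}$ deleted if it is present (and $G-ij=G$ if $\{i,j\}\notin E(G)$). For a $k$-chromatic graph $G$, a 2-subset $\{i,j\}$ of $V(G)$ is an implicit-edge of $G$ if there is no $k$-coloring of $G-ij$ in which $i$ and $j$ receive the same color; an implicit-edge may or may not belong to $E(G)$. Given a proper coloring of $G$, two distinct colors $c_1,c_2$, and a vertex $v$ colored $c_1$ (or $c_2$), the $(c_1,c_2)$-Kempe chain containing $v$ is the maximal connected subset of $V(G)$ containing $v$ all of whose vertices are colored $c_1$ or $c_2$, i.e. the connected component of $v$ in the subgraph induced by the vertices colored $c_1$ or $c_2$. *)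

(* Defs.v *)
From mathcomp Require Import all_boot.

Set Implicit Arguments.
Unset Strict Implicit.
Unset Printing Implicit Defensive.

Record sgraph (T : finType) := SGraph {
  adj :> rel T;
  adj_sym : symmetric adj;
  adj_irrefl : irreflexive adj }.

Section Graphs.
Variable T : finType.
Implicit Types (G : sgraph T) (i j u v : T).

Definition del_edge_rel G i j : rel T :=
  fun u v => G u v && ([set u; v] != [set i; j]).

Lemma del_edge_sym G i j : symmetric (del_edge_rel G i j).
Proof. by move=> u v; rewrite /del_edge_rel adj_sym setUC. Qed.

Lemma del_edge_irrefl G i j : irreflexive (del_edge_rel G i j).
Proof. by move=> u; rewrite /del_edge_rel adj_irrefl. Qed.

Definition del_edge G i j : sgraph T :=
  SGraph (del_edge_sym G i j) (del_edge_irrefl G i j).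

(* Colorings need not be surjective: not every color has to be used. *)
Definition proper_coloring G k (c : {ffun T -> 'I_k}) : bool :=
  [forall u, forall v, G u v ==> (c u != c v)].

Definition colorable G k : bool :=
  [exists c : {ffun T -> 'I_k}, proper_coloring G c].

Lemma colorable_ex G : exists k, colorable G k.
Proof.
exists #|T|; apply/existsP; exists [ffun u => enum_rank u].
apply/forallP=> u; apply/forallP=> v; apply/implyP=> Guv; rewrite !ffunE.
by apply/eqP=> /enum_rank_inj uv; rewrite uv adj_irrefl in Guv.
Qed.

Definition chromatic_number G : nat := ex_minn (colorable_ex G).

Definition chromatic k G : Prop := chromatic_number G = k.

(* Only meaningful when G is k-chromatic. *)
Definition implicit_edge k G i j : Prop :=
  i != j /\
  ~ exists c : {ffun T -> 'I_k},
      proper_coloring (del_edge G i j) c /\ c i = c j.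

Section Kempe.
Variables (G : sgraph T) (k : nat) (c : {ffun T -> 'I_k}) (c1 c2 : 'I_k).

Definition bicolored : {set T} := [set u | (c u == c1) || (c u == c2)].

Definition kempe_rel : rel T :=
  fun u v => [&& u \in bicolored, v \in bicolored & G u v].

Definition kempe_chain_of v : {set T} := [set u | connect kempe_rel v u].

Definition kempe_chain (K : {set T}) : Prop :=
  c1 != c2 /\ exists2 v, v \in bicolored & K = kempe_chain_of v.

End Kempe.

Definition simple_path G (x : T) (p : seq T) (y : T) : Prop :=
  [/\ path G x p, uniq (x :: p) & last x p = y].

End Graphs.

(* Main.v *)
(** If x and y lie in distinct Kempe chains for the colors c(x), c(y), then
    swapping these two colors on the chain of x gives a proper coloring in
    which x and y agree, contradicting that {x, y} is an implicit edge. *)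
Require Import Defs.
From mathcomp Require Import all_boot perm.

Lemma proper_coloringP {T : finType} (G : sgraph T) (k : nat)
    (c : {ffun T -> 'I_k}) :
  reflect (forall u v, G u v -> c u != c v) (proper_coloring G c).
Proof.
apply: (iffP forallP) => [cP u v | cP u].
  by move/forallP: (cP u) => /(_ v)/implyP.
by apply/forallP => v; apply/implyP; apply: cP.
Qed.

Lemma proper_coloring_del_edge {T : finType} (G : sgraph T) (i j : T) (k : nat)
    (c : {ffun T -> 'I_k}) :
  proper_coloring G c -> proper_coloring (del_edge G i j) c.
Proof.
move/proper_coloringP => cP; apply/proper_coloringP => u v /andP[Guv _].
exact: cP.
Qed.

(** Deleting an edge keeps a coloring proper, so equal colors at [i] and [j] would give the coloring
    that an implicit edge forbids. It serves both for [c] and for its Kempe swap. *)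
Lemma implicit_edge_colors_neq {T : finType} (G : sgraph T) (k : nat) (i j : T)
    (c : {ffun T -> 'I_k}) :
  implicit_edge k G i j -> proper_coloring G c -> c i <> c j.
Proof.
case=> _ nP cP cij; apply: nP.
by exists c; split=> //; apply: proper_coloring_del_edge.
Qed.

Section KempeSwap.
Variables (T : finType) (G : sgraph T) (k : nat) (c : {ffun T -> 'I_k}).
Variables (c1 c2 : 'I_k).

Lemma kempe_path (x : T) (p : seq T) :
  path (kempe_rel G c c1 c2) x p -> path G x p.
Proof. by apply: sub_path => u v /and3P[]. Qed.

Lemma path_sub_kempe_chain_of (x : T) (p : seq T) :
  path (kempe_rel G c c1 c2) x p ->
  {subset x :: p <= kempe_chain_of G c c1 c2 x}.
Proof.
by move=> xp u up; rewrite inE; apply: (path_connect xp).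
Qed.

(** If [v] has neither color, its chain is the singleton of [v] and the swap changes nothing. *)
Definition kempe_swap (v : T) : {ffun T -> 'I_k} :=
  [ffun u => if u \in kempe_chain_of G c c1 c2 v then tperm c1 c2 (c u)
             else c u].

(** Inside the chain [tperm c1 c2] is injective on colors, outside nothing changes; only edges
    leaving the chain need an argument. *)
Lemma kempe_swap_proper (v : T) :
  proper_coloring G c -> proper_coloring G (kempe_swap v).
Proof.
move/proper_coloringP => cP; apply/proper_coloringP.
have boundary u w : u \in kempe_chain_of G c c1 c2 v ->
    w \notin kempe_chain_of G c c1 c2 v -> G u w -> tperm c1 c2 (c u) != c w.
  rewrite !inE => vu vw Guw.
  have : ~~ kempe_rel G c c1 c2 u w.
    by apply: contra vw => uw; apply: connect_trans vu (connect1 uw).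
  rewrite /kempe_rel Guw andbT !inE negb_and.
  (* If [c u] is [c1] or [c2], then [w], adjacent to [u] but off the chain, has neither color;
     otherwise [tperm] fixes [c u]. *)
  case: tpermP => [->|->|_ _ _]; last exact: cP.
    by rewrite eqxx /= negb_or [c2 == _]eq_sym => /andP[].
  by rewrite eqxx orbT /= negb_or [c1 == _]eq_sym => /andP[].
move=> u w Guw; rewrite !ffunE.
case: ifPn => uK; case: ifPn => wK; last exact: cP.
- by rewrite (inj_eq perm_inj) cP.
- exact: boundary.
- by rewrite eq_sym boundary // adj_sym.
Qed.

End KempeSwap.

Theorem theorem3p16 (T : finType) (G : sgraph T) (k : nat) (x y : T)
    (hG : chromatic k G) (hxy : implicit_edge k G x y)
    (c : {ffun T -> 'I_k}) (hc : proper_coloring G c) :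
  c x <> c y /\
  exists K : {set T},
    kempe_chain G c (c x) (c y) K /\
    exists p : seq T, simple_path G x p y /\ {subset x :: p <= K}.
Proof.
have cxy := implicit_edge_colors_neq _ _ _ _ _ hxy hc.
split=> //; exists (kempe_chain_of G c (c x) (c y) x); split.
  by split; [exact/eqP | exists x; rewrite // inE eqxx].
have /connectP[p xp yE] : connect (kempe_rel G c (c x) (c y)) x y.
  apply/negPn/negP => nxy.
  have := implicit_edge_colors_neq _ _ _ _ _ hxy
    (kempe_swap_proper _ G _ c (c x) (c y) x hc).
  (* [x] lies in its own chain and is recolored [c y]; [y] lies off it and keeps [c y]. *)
  by apply; rewrite !ffunE !inE connect0 (negPf nxy) tpermL.
(* The walk from [connectP] may repeat vertices; shortening makes it simple and keeps its steps in
   [kempe_rel], hence in the chain. *)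
case: (shortenP xp) yE => q xq uq _ yE.
exists q; split; last exact: path_sub_kempe_chain_of.
by split=> //; exact: kempe_path xq.
Qed.
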